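(* For every set of formulas $\Delta\subseteq\mathcal{L}^I_1$ and every formula $\varphi\in\mathcal{L}^I_1$: if $\Delta\vDash\varphi$ then $\Delta\vdash\varphi$ in $\mathbb{SPIL}$ (strong completeness of multi-agent Public Inspection Logic).
   Context: Fix a set of constants $\mathbb{C}$ and a non-empty set of agents $I$. The language $\mathcal{L}^I_1$ is given by $\varphi ::= \top \mid \lnot\varphi \mid \varphi\land\varphi \mid \mathit{Kv}_i c \mid [c]\varphi$ with $c\in\mathbb{C}$, $i\in I$; $\langle c\rangle\varphi:=\lnot[c]\lnot\varphi$. A model is $\mathcal{M}=\langle S,\mathcal{D},V,R\rangle$ with $S$ a non-empty set of states, $\mathcal{D}$ a non-empty domain, $V:S\times\mathbb{C}\to\mathcal{D}$, and $R$ assigning to each $i\in I$ an equivalence relation $\sim_i$ on $S$; $s=_c t$ means $V(s,c)=V(t,c)$. Semantics: booleans as usual; $\mathcal{M},s\vDash\mathit{Kv}_i c$ iff for all $t\in S$, $s\sim_i t$ implies $s=_c t$; $\mathcal{M},s\vDash[c]\varphi$ iff $\mathcal{M}|^s_c,s\vDash\varphi$, where $\mathcal{M}|^s_c=\langle S',\mathcal{D},V|_{S'\times\mathbb{C}},R|_{S'\times S'}\rangle$ with $S'=\{t\in S\mid s=_c t\}$. $\Delta\vDash\varphi$ means every pointed model satisfying all of $\Delta$ satisfies $\varphi$. The proof system $\mathbb{SPIL}$ has axioms, for all $c,d\in\mathbb{C}$, $i\in I$: TAUT (propositional tautologies), DIST $[c](\varphi\to\psi)\to([c]\varphi\to[c]\psi)$,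 LEARN $[c]\mathit{Kv}_i c$, NF $\mathit{Kv}_i c\to[d]\mathit{Kv}_i c$, DET $\langle c\rangle\varphi\leftrightarrow[c]\varphi$, COMM $[c][d]\varphi\leftrightarrow[d][c]\varphi$, RIR $\mathit{Kv}_i c\to([c]\varphi\to\varphi)$ for every $\varphi$ that mentions no agent other than $i$; and rules MP and NEC (from $\varphi$ infer $[c]\varphi$). $\Delta\vdash\varphi$ means $\vdash(\psi_1\land\dots\land\psi_k)\to\varphi$ for some $\psi_1,\dots,\psi_k\in\Delta$. *)

(* Defs.v *)
From Stdlib Require Export List RelationClasses.
Export ListNotations.

Set Implicit Arguments.
Unset Strict Implicit.
Unset Printing Implicit Defensive.

Inductive form (Const Agent : Type) : Type :=
  | Top
  | Neg (f : form Const Agent)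
  | And (f g : form Const Agent)
  | Kv (i : Agent) (c : Const)
  | Box (c : Const) (f : form Const Agent).

Arguments Top {Const Agent}.
Arguments Kv {Const Agent}.

Definition Imp {Const Agent : Type} (f g : form Const Agent) :=
  Neg (And f (Neg g)).

Definition Iff {Const Agent : Type} (f g : form Const Agent) :=
  And (Imp f g) (Imp g f).

Definition Dia {Const Agent : Type} (c : Const) (f : form Const Agent) :=
  Neg (Box c (Neg f)).

Record model (Const Agent : Type) : Type := Model {
  state : Type;
  dom : Type;
  val : state -> Const -> dom;
  acc : Agent -> state -> state -> Prop;
  state_nonempty : inhabited state;
  dom_nonempty : inhabited dom;
  acc_equiv : forall i, Equivalence (acc i) }.

Definition restrict_state {Const Agent : Type} (M : model Const Agent)
    (s : state M) (c : Const) : Type :=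
  {t : state M | val s c = val t c}.

Definition restrict_point {Const Agent : Type} (M : model Const Agent)
    (s : state M) (c : Const) : restrict_state s c :=
  exist _ s eq_refl.

Definition restrict_acc {Const Agent : Type} (M : model Const Agent)
    (s : state M) (c : Const) (i : Agent) (t u : restrict_state s c) : Prop :=
  acc i (proj1_sig t) (proj1_sig u).

Lemma restrict_acc_equiv {Const Agent : Type} (M : model Const Agent)
    (s : state M) (c : Const) (i : Agent) :
  Equivalence (@restrict_acc Const Agent M s c i).
Proof.
destruct (acc_equiv M i) as [r y t].
split; unfold restrict_acc.
- intros u; apply r.
- intros u v; apply y.
- intros u v w; apply t.
Qed.

Definition restrict {Const Agent : Type} (M : model Const Agent)
    (s : state M) (c : Const) : model Const Agent := {|
  state := restrict_state s c;
  dom := dom M;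
  val := fun t d => val (proj1_sig t) d;
  acc := @restrict_acc Const Agent M s c;
  state_nonempty := inhabits (restrict_point s c);
  dom_nonempty := dom_nonempty M;
  acc_equiv := @restrict_acc_equiv Const Agent M s c |}.

Fixpoint sat {Const Agent : Type} (M : model Const Agent) (s : state M)
    (f : form Const Agent) {struct f} : Prop :=
  match f with
  | Top => True
  | Neg g => ~ sat s g
  | And g h => sat s g /\ sat s h
  | Kv i c => forall t : state M, acc i s t -> val s c = val t c
  | Box c g => @sat Const Agent (restrict s c) (restrict_point s c) g
  end.

Definition entails {Const Agent : Type} (Delta : form Const Agent -> Prop)
    (f : form Const Agent) : Prop :=
  forall (M : model Const Agent) (s : state M),
    (forall g, Delta g -> sat s g) -> sat s f.

(* Formulas headed by [Kv] or [Box] are the propositional atoms: [v] fixes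
   their truth values, and its values on other formulas are irrelevant. *)
Fixpoint prop_eval {Const Agent : Type} (v : form Const Agent -> bool)
    (f : form Const Agent) : bool :=
  match f with
  | Top => true
  | Neg g => negb (prop_eval v g)
  | And g h => andb (prop_eval v g) (prop_eval v h)
  | Kv _ _ | Box _ _ => v f
  end.

Definition tautology {Const Agent : Type} (f : form Const Agent) : Prop :=
  forall v, prop_eval v f = true.

Fixpoint only_agent {Const Agent : Type} (i : Agent) (f : form Const Agent)
    : Prop :=
  match f with
  | Top => True
  | Neg g => only_agent i g
  | And g h => only_agent i g /\ only_agent i h
  | Kv j _ => j = i
  | Box _ g => only_agent i g
  end.

Inductive SPIL {Const Agent : Type} : form Const Agent -> Prop :=
  | TAUT f : tautology f -> SPIL f
  | DIST c f g : SPIL (Imp (Box c (Imp f g)) (Imp (Box c f) (Box c g)))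
  | LEARN c i : SPIL (Box c (Kv i c))
  | NF c d i : SPIL (Imp (Kv i c) (Box d (Kv i c)))
  | DET c f : SPIL (Iff (Dia c f) (Box c f))
  | COMM c d f : SPIL (Iff (Box c (Box d f)) (Box d (Box c f)))
  | RIR c i f : only_agent i f -> SPIL (Imp (Kv i c) (Imp (Box c f) f))
  | MP f g : SPIL (Imp f g) -> SPIL f -> SPIL g
  | NEC c f : SPIL f -> SPIL (Box c f).

Fixpoint conj_list {Const Agent : Type} (l : list (form Const Agent))
    : form Const Agent :=
  match l with
  | [] => Top
  | [f] => f
  | f :: l' => And f (conj_list l')
  end.

Definition derives {Const Agent : Type} (Delta : form Const Agent -> Prop)
    (f : form Const Agent) : Prop :=
  exists l : list (form Const Agent),
    (forall g, In g l -> Delta g) /\ SPIL (Imp (conj_list l) f).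

(* Main.v *)
Require Import Defs.
From Stdlib Require Import Bool Classical PropExtensionality.
From mathcomp Require classical_sets.

Set Implicit Arguments.
Unset Strict Implicit.
Unset Printing Implicit Defensive.

(** Since [DET] makes [Box c] commute with negation, every formula is a Boolean
    combination of formulas [[c_1]...[c_n]Kv_i d].  Relative to a maximal theory
    [G], the relation "[[c_1]...[c_n]Kv_i d] is in [G]" between finite sets of
    constants and constants is, for each agent [i], the entailment relation of a
    finitary closure operator: [LEARN] and [NF] give reflexivity and
    monotonicity, [RIR] gives cut.  The canonical model has a root and one
    state for each agent [i] and each set [A] of constants; only when [A] is
    closed for [i] does agent [i] confuse that state with the root, and it
    agrees with the root exactly on [A]. *)

(** * Truth-table reasoning inside [SPIL] and the deduction theorem *)

Section PropositionalReasoning.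

Context {Const Agent : Type}.
Implicit Types (f g h : form Const Agent) (l : list (form Const Agent)).
Implicit Types X Y : form Const Agent -> Prop.

Definition taut_entails l f : Prop :=
  forall v, forallb (prop_eval v) l = true -> prop_eval v f = true.

Lemma prop_eval_Imp v f g :
  prop_eval v (Imp f g) = implb (prop_eval v f) (prop_eval v g).
Proof. simpl; destruct (prop_eval v f), (prop_eval v g); reflexivity. Qed.

Lemma prop_eval_conj_list v l :
  prop_eval v (conj_list l) = forallb (prop_eval v) l.
Proof.
induction l as [|f [|g l] IH]; simpl in *.
- reflexivity.
- now rewrite andb_true_r.
- now rewrite IH.
Qed.

(** The premises are moved one by one into nested implications, which end in an instance of [TAUT].
    Propositional steps thereby reduce to case analysis on truth values. *)
Lemma SPIL_taut l f :
  (forall g, In g l -> SPIL g) -> taut_entails l f -> SPIL f.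
Proof.
revert f; induction l as [|g l IH]; intros f Hl Hf.
- apply TAUT; intro v; now apply Hf.
- apply MP with g; [|now apply Hl; left].
  apply IH; [now intros; apply Hl; right|].
  intros v Hv; rewrite prop_eval_Imp.
  destruct (prop_eval v g) eqn:Hg; [simpl|reflexivity].
  now apply Hf; simpl; rewrite Hg, Hv.
Qed.

Lemma derives_SPIL X f : SPIL f -> derives X f.
Proof.
intro Hf; exists []; split; [intros g []|].
apply (SPIL_taut (l := [f])); [now intros g [<-|[]]|].
intros v; simpl; now destruct (prop_eval v f).
Qed.

Lemma derives_hyp X f : X f -> derives X f.
Proof.
intro Hf; exists [f]; split; [now intros g [<-|[]]|].
apply TAUT; intro v; simpl; now destruct (prop_eval v f).
Qed.

Lemma derives_mp X f g : derives X (Imp f g) -> derives X f -> derives X g.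
Proof.
intros [l [Hl Pl]] [k [Hk Pk]]; exists (l ++ k); split.
- intros h Hh; apply in_app_or in Hh as [Hh|Hh]; auto.
- apply (SPIL_taut (l := [Imp (conj_list l) (Imp f g); Imp (conj_list k) f])).
  + now intros h [<-|[<-|[]]].
  + intros v; cbn [forallb].
    rewrite !prop_eval_Imp, !prop_eval_conj_list, forallb_app.
    now destruct (forallb _ l), (forallb _ k), (prop_eval v f), (prop_eval v g).
Qed.

Lemma derives_taut X l f :
  (forall g, In g l -> derives X g) -> taut_entails l f -> derives X f.
Proof.
revert f; induction l as [|g l IH]; intros f Hl Hf.
- apply derives_SPIL, TAUT; intro v; now apply Hf.
- apply derives_mp with g; [|now apply Hl; left].
  apply IH; [now intros; apply Hl; right|].
  intros v Hv; rewrite prop_eval_Imp.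
  destruct (prop_eval v g) eqn:Hg; [simpl|reflexivity].
  now apply Hf; simpl; rewrite Hg, Hv.
Qed.

Lemma derives_mono X Y f :
  (forall g, X g -> Y g) -> derives X f -> derives Y f.
Proof. intros HXY [l [Hl Pl]]; exists l; auto. Qed.

(** Dropping the occurrences of [f] from the list of premises leaves a list from [X] that, together
    with [f], still entails the old conjunction. *)
Lemma derives_deduction X f h :
  derives (fun g => X g \/ g = f) h -> derives X (Imp f h).
Proof.
intros [l [Hl Pl]].
assert (Hk : exists k, (forall g, In g k -> X g) /\
    taut_entails (f :: k) (conj_list l)).
{ clear Pl; induction l as [|g l IH].
  - exists []; split; [intros g []|intros v _; reflexivity].
  - destruct IH as [k [Hk Tk]]; [now intros; apply Hl; right|].
    unfold taut_entails in *.
    setoid_rewrite prop_eval_conj_list in Tk.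
    setoid_rewrite prop_eval_conj_list.
    destruct (Hl g (or_introl eq_refl)) as [Hg| ->].
    + exists (g :: k); split; [now intros u [<-|Hu]; auto|].
      intros v Hv; specialize (Tk v); simpl in *.
      destruct (prop_eval v f), (prop_eval v g); now auto.
    + exists k; split; [assumption|].
      intros v Hv; specialize (Tk v Hv); simpl in *.
      rewrite Tk; now destruct (prop_eval v f). }
destruct Hk as [k [Hk Tk]]; exists k; split; [assumption|].
apply (SPIL_taut (l := [Imp (conj_list l) h])); [now intros g [<-|[]]|].
intros v; specialize (Tk v); cbn [forallb] in *.
rewrite !prop_eval_Imp, !prop_eval_conj_list in *.
destruct (forallb _ k), (forallb _ l), (prop_eval v f), (prop_eval v h);
  simpl in *; now auto.
Qed.

End PropositionalReasoning.

(** * Maximal theories and Lindenbaum's lemma *)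

Section MaximalTheories.

Context {Const Agent : Type}.
Implicit Types (f g : form Const Agent) (X : form Const Agent -> Prop).

(** The two directions of [theory_Neg] are consistency and completeness. *)
Record maximal_theory (G : form Const Agent -> Prop) : Prop := {
  theory_SPIL : forall f, SPIL f -> G f;
  theory_mp : forall f g, G (Imp f g) -> G f -> G g;
  theory_Neg : forall f, G (Neg f) <-> ~ G f }.

(** A derivation has finitely many premises, so those taken from the chain all lie in one of its
    members. The first alternative covers derivations from [X] alone, as for the empty chain. *)
Lemma derives_chain X (F : (form Const Agent -> Prop) -> Prop) f :
  classical_sets.total_on F classical_sets.subset ->
  derives (fun g => X g \/ exists2 Y, F Y & Y g) f ->
  derives X f \/ exists2 Y, F Y & derives (fun g => X g \/ Y g) f.
Proof.
intros HF [l [Hl Pl]].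
assert (H : (forall g, In g l -> X g) \/
    exists2 Y, F Y & forall g, In g l -> X g \/ Y g).
{ clear Pl; induction l as [|g l IH]; [left; intros g []|].
  destruct IH as [IH|[Y FY IH]]; [now intros; apply Hl; right| |];
  destruct (Hl g (or_introl eq_refl)) as [Hg|[Z FZ Hg]].
  - left; now intros h [<-|Hh]; auto.
  - right; exists Z; [assumption|]; now intros h [<-|Hh]; auto.
  - right; exists Y; [assumption|]; now intros h [<-|Hh]; auto.
  - right; destruct (HF Y Z FY FZ) as [YZ|ZY].
    + exists Z; [assumption|]; intros h [<-|Hh]; [now right|].
      destruct (IH h Hh); auto.
    + exists Y; [assumption|]; now intros h [<-|Hh]; auto. }
destruct H as [H|[Y FY H]]; [left|right; exists Y; [assumption|]];
  exists l; auto.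
Qed.

Lemma lindenbaum X f :
  ~ derives X f ->
  exists G, maximal_theory G /\ (forall g, X g -> G g) /\ ~ G f.
Proof.
intro Hf.
destruct (@classical_sets.Zorn_bigcup (form Const Agent)
  (fun A => ~ derives (fun g => X g \/ A g) f)) as [A [HA maxA]].
{ intros F FP Ftot D.
  destruct (derives_chain (X := X) Ftot D) as [D'|[Y FY D']]; [now apply Hf|].
  exact (FP Y FY D'). }
set (G := derives (fun g => X g \/ A g)).
(* If [g] is not in [G], adding it to [A] gives a strictly larger set, which by maximality derives
   [f] together with [X]. *)
assert (ext : forall g, ~ G g -> G (Imp g f)).
{ intros g Hg; apply derives_deduction; apply NNPP; intro D.
  apply (maxA (fun h => A h \/ h = g)).
  - split; [now left|]; intro sub; apply Hg, derives_hyp; right.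
    apply sub; now right.
  - intro D'; apply D; revert D'; apply derives_mono; tauto. }
exists G; split; [|split; [now intros; apply derives_hyp; left|exact HA]].
split.
- intros g; apply derives_SPIL.
- intros g h; apply derives_mp.
- intro g; split.
  + intros Hn Hg; apply HA; apply (derives_taut (l := [Neg g; g]));
      [now intros ? [<-|[<-|[]]]|]; intros v; simpl;
      now destruct (prop_eval v g).
  (* If both [g] and its negation were missing, each would imply [f], and [f] would follow by
     cases. *)
  + intro Hg; apply NNPP; intro Hn; apply HA.
    apply (derives_taut (l := [Imp g f; Imp (Neg g) f])).
    * intros ? [<-|[<-|[]]]; now apply ext.
    * intros v; simpl; now destruct (prop_eval v g), (prop_eval v f).
Qed.

End MaximalTheories.

(** * Laws of iterated boxes and the closure properties of knowledge *)

Section IteratedBoxes.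

Context {Const Agent : Type}.
Implicit Types (f g h : form Const Agent) (L : list Const).

(* The head of the list is the innermost box. *)
Fixpoint boxes L f : form Const Agent :=
  match L with
  | [] => f
  | c :: L' => boxes L' (Box c f)
  end.

Lemma boxes_app L K f : boxes (L ++ K) f = boxes K (boxes L f).
Proof. revert f; induction L as [|c L IH]; simpl; auto. Qed.

Lemma SPIL_Imp_trans f g h : SPIL (Imp f g) -> SPIL (Imp g h) -> SPIL (Imp f h).
Proof.
intros Hf Hg; apply (SPIL_taut (l := [Imp f g; Imp g h]));
  [now intros ? [<-|[<-|[]]]|]; intros v; simpl.
now destruct (prop_eval v f), (prop_eval v g), (prop_eval v h).
Qed.

Lemma SPIL_Imp_refl f : SPIL (Imp f f).
Proof. apply TAUT; intro v; simpl; now destruct (prop_eval v f). Qed.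

Lemma SPIL_Iff_l f g : SPIL (Iff f g) -> SPIL (Imp f g).
Proof.
intro H; apply (SPIL_taut (l := [Iff f g])); [now intros ? [<-|[]]|].
intros v; simpl; now destruct (prop_eval v f), (prop_eval v g).
Qed.

Lemma Box_mono c f g : SPIL (Imp f g) -> SPIL (Imp (Box c f) (Box c g)).
Proof. intro H; eapply MP; [apply DIST|now apply NEC]. Qed.

Lemma boxes_NEC L f : SPIL f -> SPIL (boxes L f).
Proof.
revert f; induction L as [|c L IH]; simpl; intros f H; [assumption|].
now apply IH, NEC.
Qed.

Lemma boxes_mono L f g : SPIL (Imp f g) -> SPIL (Imp (boxes L f) (boxes L g)).
Proof.
revert f g; induction L as [|c L IH]; simpl; intros f g H; [assumption|].
now apply IH, Box_mono.
Qed.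

Lemma boxes_DIST L f g :
  SPIL (Imp (boxes L (Imp f g)) (Imp (boxes L f) (boxes L g))).
Proof.
revert f g; induction L as [|c L IH]; simpl; intros f g.
- apply SPIL_Imp_refl.
- eapply SPIL_Imp_trans; [apply boxes_mono, DIST|apply IH].
Qed.

Lemma Box_Neg c f : SPIL (Imp (Box c (Neg f)) (Neg (Box c f))).
Proof.
apply (SPIL_taut (l := [Iff (Dia c f) (Box c f)]));
  [now intros ? [<-|[]]; apply DET|]; intros v; simpl.
now destruct (v (Box c f)), (v (Box c (Neg f))).
Qed.

Lemma Neg_Box c f : SPIL (Imp (Neg (Box c f)) (Box c (Neg f))).
Proof.
apply (SPIL_taut (l := [Iff (Dia c f) (Box c f)]));
  [now intros ? [<-|[]]; apply DET|]; intros v; simpl.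
now destruct (v (Box c f)), (v (Box c (Neg f))).
Qed.

Lemma boxes_Neg L f : SPIL (Imp (boxes L (Neg f)) (Neg (boxes L f))).
Proof.
revert f; induction L as [|c L IH]; simpl; intro f; [apply SPIL_Imp_refl|].
eapply SPIL_Imp_trans; [apply boxes_mono, Box_Neg|apply IH].
Qed.

Lemma Neg_boxes L f : SPIL (Imp (Neg (boxes L f)) (boxes L (Neg f))).
Proof.
revert f; induction L as [|c L IH]; simpl; intro f; [apply SPIL_Imp_refl|].
eapply SPIL_Imp_trans; [apply IH|apply boxes_mono, Neg_Box].
Qed.

Lemma Box_boxes_comm c L f : SPIL (Imp (Box c (boxes L f)) (boxes L (Box c f))).
Proof.
revert f; induction L as [|d L IH]; simpl; intro f; [apply SPIL_Imp_refl|].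
eapply SPIL_Imp_trans; [apply IH|apply boxes_mono, SPIL_Iff_l, COMM].
Qed.

Lemma boxes_comm K L f :
  SPIL (Imp (boxes K (boxes L f)) (boxes L (boxes K f))).
Proof.
revert f; induction K as [|c K IH]; simpl; intro f; [apply SPIL_Imp_refl|].
eapply SPIL_Imp_trans; [apply boxes_mono, Box_boxes_comm|apply IH].
Qed.

Lemma Kv_boxes L i c : SPIL (Imp (Kv i c) (boxes L (Kv i c))).
Proof.
induction L as [|d L IH]; simpl; [apply SPIL_Imp_refl|].
eapply SPIL_Imp_trans; [apply IH|apply boxes_mono, NF].
Qed.

(** Split [L] at [c]: [LEARN] gives the box of [c], [NF] inserts the boxes inside it, and [NEC] adds
    those outside. *)
Lemma boxes_Kv_In L i c : In c L -> SPIL (boxes L (Kv i c)).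
Proof.
intro H; destruct (in_split _ _ H) as [L1 [L2 ->]].
rewrite boxes_app; simpl; apply boxes_NEC.
eapply MP; [apply Box_mono, Kv_boxes|apply LEARN].
Qed.

Lemma only_agent_boxes i L f : only_agent i f -> only_agent i (boxes L f).
Proof. revert f; induction L as [|c L IH]; simpl; auto. Qed.

Section InMaximalTheory.

Variable G : form Const Agent -> Prop.
Hypothesis maxG : maximal_theory G.

Lemma theory_imp f g : SPIL (Imp f g) -> G f -> G g.
Proof. intro H; apply (theory_mp maxG), (theory_SPIL maxG), H. Qed.

Lemma theory_boxes_mp L f g :
  G (boxes L (Imp f g)) -> G (boxes L f) -> G (boxes L g).
Proof.
intro H; apply (theory_mp maxG); exact (theory_imp (boxes_DIST L f g) H).
Qed.

Lemma theory_boxes_Neg L f : G (boxes L (Neg f)) <-> ~ G (boxes L f).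
Proof.
rewrite <- (theory_Neg maxG).
split; apply theory_imp; [apply boxes_Neg|apply Neg_boxes].
Qed.

Lemma theory_boxes_And L f g :
  G (boxes L (And f g)) <-> G (boxes L f) /\ G (boxes L g).
Proof.
split.
- intro H; split; revert H; apply theory_imp, boxes_mono, TAUT; intros v; simpl;
    now destruct (prop_eval v f), (prop_eval v g).
- intros [Hf Hg]; revert Hg; apply theory_boxes_mp.
  revert Hf; apply theory_imp, boxes_mono, TAUT; intros v; simpl.
  now destruct (prop_eval v f), (prop_eval v g).
Qed.

(** First [NF] and [COMM] put the boxes of [K] under those of [L]; then [RIR], used under [L],
    strips them one at a time. The side condition of [RIR] holds because the formula below the
    stripped box is [Kv i c] under boxes, with [i] as its only agent. *)
Lemma theory_Kv_cut L K i c :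
  (forall d, In d K -> G (boxes L (Kv i d))) ->
  G (boxes K (Kv i c)) -> G (boxes L (Kv i c)).
Proof.
intros HK Hc.
assert (H : G (boxes L (boxes K (Kv i c)))).
{ revert Hc; apply theory_imp.
  eapply SPIL_Imp_trans; [apply boxes_mono, (Kv_boxes L)|apply boxes_comm]. }
clear Hc; revert HK H; induction K as [|d K IH]; simpl; intros HK H; [exact H|].
apply IH; [now auto|].
(* As head of the list, [d] is the innermost box of [K]; it must come outermost for [RIR] to remove
   it. *)
assert (H' : G (boxes L (Box d (boxes K (Kv i c))))).
{ revert H; apply theory_imp, boxes_mono.
  exact (boxes_comm K [d] (Kv i c)). }
revert H'; apply theory_boxes_mp.
generalize (HK d (or_introl eq_refl)); apply theory_imp, boxes_mono, RIR.
now apply only_agent_boxes.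
Qed.

End InMaximalTheory.

End IteratedBoxes.

(** * The canonical model and its truth lemma *)

Section CanonicalModel.

Context {Const Agent : Type}.

(* Satisfaction in the model updated by the constants of [L], without changing
   the type of states. *)
Fixpoint sat_after (M : model Const Agent) (s : state M) (L : list Const)
    (f : form Const Agent) : Prop :=
  match f with
  | Top => True
  | Neg g => ~ sat_after s L g
  | And g h => sat_after s L g /\ sat_after s L h
  | Kv i c => forall t : state M, acc i s t ->
      (forall d, In d L -> val s d = val t d) -> val s c = val t c
  | Box c g => sat_after s (c :: L) g
  end.

(** Later updates are consed in front, so the restriction by [c], made first, stands at the end of
    the list. *)
Lemma sat_after_restrict (M : model Const Agent) (s : state M) c L f :
  sat_after (restrict_point s c : state (restrict s c)) L f <->
  sat_after s (L ++ [c]) f.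
Proof.
revert L; induction f as [|f IH|f IHf g IHg|i d|d f IH]; intro L; simpl.
- reflexivity.
- now rewrite IH.
- now rewrite IHf, IHg.
- split.
  + intros H t st Ht.
    assert (e : val s c = val t c) by (apply Ht, in_or_app; right; now left).
    apply (H (exist _ t e) st); intros b Hb; apply Ht, in_or_app; now left.
  + intros H [t e] st Ht; apply (H t st); intros b Hb.
    apply in_app_or in Hb as [Hb|[<-|[]]]; [now apply Ht|exact e].
- apply (IH (d :: L)).
Qed.

Lemma sat_sat_after (M : model Const Agent) (s : state M) f :
  sat s f <-> sat_after s [] f.
Proof.
revert M s; induction f as [|f IH|f IHf g IHg|i d|d f IH]; intros M s; simpl.
- reflexivity.
- now rewrite IH.
- now rewrite IHf, IHg.
- split; [now auto|]; intros H t st; apply (H t st); intros b [].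
- rewrite IH; apply (sat_after_restrict s d []).
Qed.

Variable G : form Const Agent -> Prop.
Hypothesis maxG : maximal_theory G.

Definition closed (i : Agent) (A : Const -> Prop) : Prop :=
  forall L c, (forall d, In d L -> A d) -> G (boxes L (Kv i c)) -> A c.

Definition root_cell (i : Agent) (s : option (Agent * (Const -> Prop))) : Prop :=
  match s with
  | None => True
  | Some (j, A) => j = i /\ closed i A
  end.

(** Outside the root's cell every class of agent [i] is a singleton. Sets that are not closed thus
    stay as harmless isolated states, and the state type carries no proofs. *)
Definition canonical_acc i s t : Prop := s = t \/ root_cell i s /\ root_cell i t.

Lemma canonical_acc_equiv i : Equivalence (canonical_acc i).
Proof.
unfold canonical_acc; split.
- now left.
- intros s t [->|[Hs Ht]]; auto.
- intros s t u [->|[Hs Ht]] [->|[Ht' Hu]]; auto.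
Qed.

(* Values are propositions, so that [Some (j, A)] agrees with [None] on [c]
   exactly when [A c] holds. *)
Definition canonical_model : model Const Agent := {|
  state := option (Agent * (Const -> Prop));
  dom := Prop;
  val := fun s c => match s with None => True | Some (_, A) => A c end;
  acc := canonical_acc;
  state_nonempty := inhabits None;
  dom_nonempty := inhabits True;
  acc_equiv := canonical_acc_equiv |}.

Lemma True_eq (P : Prop) : True = P <-> P.
Proof.
split; [now intros <-|].
intro HP; apply propositional_extensionality; tauto.
Qed.

(** The root suffices: boxes never move the point of evaluation, and [Kv] only compares values at
    other states. Generalizing over [L] makes the [Box] case the induction hypothesis for a longer
    list. *)
Lemma canonical_truth f L :
  sat_after (None : state canonical_model) L f <-> G (boxes L f).
Proof.
revert L; induction f as [|f IH|f IHf g IHg|i c|c f IH]; intro L.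
- split; [intros _|easy].
  apply (theory_SPIL maxG), boxes_NEC, TAUT; now intro v.
- now rewrite (theory_boxes_Neg maxG), <- IH.
- now rewrite (theory_boxes_And maxG), <- IHf, <- IHg.
- simpl; split.
  + intro H.
    (* This is the closure of [L] for agent [i]; it contains [L], so its state survives the updates
       and tests whether [c] is in it. *)
    set (A := fun d => G (boxes L (Kv i d))).
    assert (HA : closed i A).
    { intros K d HK; now apply theory_Kv_cut. }
    apply (proj1 (True_eq (A c))).
    apply (H (Some (i, A))); [now right; repeat split|].
    intros d Hd; apply True_eq, (theory_SPIL maxG), boxes_Kv_In, Hd.
  + intros H [[j A]|] acc_t agree; [|reflexivity].
    destruct acc_t as [e|[_ [_ HA]]]; [discriminate e|].
    (* Surviving the updates means that [A] contains [L], and closedness then puts [c] in [A]. *)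
    apply True_eq, (HA L); [|exact H].
    intros d Hd; now apply True_eq, agree.
- apply (IH (c :: L)).
Qed.

End CanonicalModel.

Theorem theorem3 (Const Agent : Type) (Agent_nonempty : inhabited Agent)
    (Delta : form Const Agent -> Prop) (phi : form Const Agent) :
  entails Delta phi -> derives Delta phi.
Proof.
intro H; apply NNPP; intro N.
destruct (lindenbaum N) as [G [maxG [DG Gphi]]].
assert (truth : forall f,
    sat (None : state (canonical_model G)) f <-> G f).
{ intro f; rewrite sat_sat_after; exact (canonical_truth maxG f []). }
apply Gphi, truth, H; intros g Hg; now apply truth, DG.
Qed.
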